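(* Let $s \ge 2$ and let $X$ be an $s$-distance set contained in the unit sphere $S^{d-1} \subset \mathbb{R}^d$, with $B(X) = \{\beta_1, \ldots, \beta_s\}$. Let $N = \binom{d+s-2}{s-1} + \binom{d+s-3}{s-2}$. If $|X| \ge 2N$, then for each $i = 1, \ldots, s$ the number \[ k_i = \prod_{j=1,\ldots,s,\ j \neq i} \frac{1 - \beta_j}{\beta_i - \beta_j} \] is an integer, and $|k_i| \le U(N)$.
   Context: A finite set $X \subset \mathbb{R}^d$ is an $s$-distance set if the set of Euclidean distances between distinct points of $X$ has exactly $s$ elements. For $X \subset S^{d-1}$, $B(X) = \{(x,y) : x, y \in X, x \neq y\}$, where $(\cdot,\cdot)$ is the standard inner product (so for $X\subset S^{d-1}$, $|B(X)|=s$). The function $U$ is defined by $U(N) = \left\lfloor \frac{1}{2} + \sqrt{\frac{N^2}{2N-2} + \frac{1}{4}} \right\rfloor$. *)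

(* Defs.v *)
From mathcomp Require Import all_boot all_order all_algebra.
From mathcomp Require Import all_classical all_reals.
Set Implicit Arguments. Unset Strict Implicit. Unset Printing Implicit Defensive.
Import Order.TTheory GRing.Theory Num.Theory.
Local Open Scope ring_scope.

Definition dotv (R : realType) (d : nat) (u v : 'rV[R]_d) : R :=
  \sum_(i < d) u 0 i * v 0 i.

Definition Ufun (R : realType) (N : nat) : int :=
  Num.floor (2^-1 + Num.sqrt ((N%:R ^+ 2) / (2 * N%:R - 2) + 4^-1) : R).

(* Main.v *)
(** Let L be the Lagrange polynomial of degree s-1 with L(beta_i) = 1 and
    L(beta_j) = 0 for j <> i.  The matrix L(Gram) of X equals k_i I + A, where A
    is the adjacency matrix of the graph "(x, y) = beta_i".  On the sphere every
    polynomial of degree at most s-1 is a sum of two homogeneous ones, of degrees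
    s-1 and s-2, so this matrix has rank at most N.  Hence -k_i is an eigenvalue
    of A of multiplicity at least |X| - N >= |X| / 2, and so are its conjugates,
    which therefore number at most two.  If there are two, then |X| = 2N and A is
    annihilated by a rational quadratic q; the diagonal of q(A) = 0 makes the
    graph regular, and its degree is a rational root of q, a contradiction.  So
    k_i is rational, hence an integer.  For the bound, apply
    (tr M)^2 <= rank M * ||M||^2 to M = (L - 1/2)(Gram), which also has rank at
    most N and whose off-diagonal entries are all 1/2 or -1/2. *)

Require Import Defs.
From mathcomp Require Import all_boot all_order all_algebra.
From mathcomp Require Import all_classical all_reals.
From mathcomp Require Import ring lra zify.
Set Implicit Arguments. Unset Strict Implicit. Unset Printing Implicit Defensive.
Import Order.TTheory GRing.Theory Num.Theory.
Local Open Scope ring_scope.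

(** * Integrality of graph eigenvalues of large multiplicity *)

(** Geometric multiplicity is at most algebraic: the normal form [B = L P U] turns [X - A] into
    [L (y W - P) U]. *)
Lemma dvdp_char_poly_rank (F : fieldType) n (A : 'M[F]_n) (a : F) :
  ('X - a%:P) ^+ (n - \rank (A - a%:M)) %| char_poly A.
Proof.
set B := A - a%:M; set r := \rank B; set y : {poly F} := 'X - a%:P.
pose L := map_mx polyC (col_ebase B); pose U := map_mx polyC (row_ebase B).
have LV : L *m map_mx polyC (invmx (col_ebase B)) = 1%:M.
  by rewrite -map_mxM mulmxV ?col_ebase_unit // map_mx1.
have UV : map_mx polyC (invmx (row_ebase B)) *m U = 1%:M.
  by rewrite -map_mxM mulVmx ?row_ebase_unit // map_mx1.
pose W := map_mx polyC (invmx (col_ebase B) *m invmx (row_ebase B)).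
pose P : 'M[{poly F}]_n := pid_mx r.
have defA : char_poly_mx A = L *m (y *: W - P) *m U.
  rewrite mulmxBr mulmxBl -scalemxAr -scalemxAl /W map_mxM mulmxA LV mul1mx UV.
  have -> : L *m P *m U = map_mx polyC B.
    by rewrite -[in RHS](mulmx_ebase B) !map_mxM map_pid_mx.
  by rewrite scalemx1 /B map_mxB map_scalar_mx /char_poly_mx /y raddfB /= opprB addrA subrK.
pose D : 'rV[{poly F}]_n := \row_j (if (j < r)%N then 1 else y).
pose W' : 'M[{poly F}]_n := \matrix_(i, j) (if (i < r)%N then (y *: W - P) i j else W i j).
have defW : y *: W - P = diag_mx D *m W'.
  apply/matrixP => i j; rewrite mul_diag_mx !mxE.
  by case: ifP => _; rewrite ?mul1r // andbF subr0.
(* The [n - r] rows of [y *: W - P] below row [r] are divisible by [y]. *)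
rewrite /char_poly defA defW !det_mulmx det_diag.
apply/dvdp_mulr/dvdp_mull/dvdp_mulr.
have -> : \prod_i D 0 i = y ^+ (n - r).
  rewrite (eq_bigr (fun i : 'I_n => if (r <= i)%N then y else 1)); last first.
    by move=> i _; rewrite mxE ltnNge; case: leqP.
  rewrite -big_mkcond /= prodr_const; congr (_ ^+ _).
  rewrite -sum1_card.
  have -> : (\sum_(i in [pred i : 'I_n | r <= i]) 1)%N = (\sum_(0 <= i < n | r <= i) 1)%N.
    by rewrite big_mkord.
  rewrite big_mkcond (big_cat_nat _ (n := r)) ?rank_leq_row //=.
  rewrite [X in (X + _)%N]big1_seq => [|i]; last first.
    by rewrite mem_index_iota => /andP[_ /andP[_ ltir]]; rewrite leqNgt ltir.
  rewrite (eq_big_nat _ _ (F2 := fun=> 1%N)) => [|i /andP[-> _] //].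
  by rewrite sum_nat_const_nat add0n muln1.
exact: dvdpp.
Qed.

(** If [B ^+ m.+2 = 0], the symmetric [C = B ^+ m.+1] has [C C^T = 0], whose diagonal entries are
    sums of squares; so [C = 0] and the exponent drops. *)
Lemma sym_nilpotent_eq0 (F : realFieldType) n (B : 'M[F]_n.+1) m :
  B^T = B -> B ^+ m = 0 -> B = 0.
Proof.
move=> symB; elim: m => [|[|m] IHm] Bm0; first by rewrite -[B]mulr1 -[1](expr0 B) Bm0 mulr0.
  by rewrite -[B]expr1.
apply: IHm; set C := B ^+ m.+1.
have symC : C^T = C.
  by rewrite /C; elim: (m.+1) => [|k IH]; rewrite ?trmx1 // [in LHS]exprS trmx_mul symB IH [RHS]exprSr.
have C2 : C *m C^T = 0.
  by rewrite symC -[_ *m _]/(C * C) -exprD addnS -addSn exprD Bm0 mul0r.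
apply/matrixP => i j; rewrite [RHS]mxE.
have /matrixP/(_ i i) := C2; rewrite !mxE => /eqP.
rewrite psumr_eq0 => [/allP/(_ j)|l _]; last by rewrite [C^T _ _]mxE -expr2 sqr_ge0.
by rewrite mem_index_enum [C^T _ _]mxE mulf_eq0 orbb => /(_ isT)/eqP.
Qed.

(** Remainders modulo an annihilator of least size also vanish at [z]. The divisibility property
    stands in for irreducibility below. *)
Lemma minimal_poly_exists (F : fieldType) (L : fieldType) (f : {rmorphism F -> L})
    (z : L) (p : {poly F}) :
  p != 0 -> root (map_poly f p) z ->
  exists q : {poly F}, [/\ q \is monic, root (map_poly f q) z &
    forall r, root (map_poly f r) z -> q %| r].
Proof.
move=> p0 pz.
pose P n := `[< exists q : {poly F}, [/\ q != 0, root (map_poly f q) z & size q = n] >].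
have exP : exists n, P n by exists (size p); apply/asboolP; exists p.
have [n /asboolP[q [q0 qz sq]] minn] := ex_minnP exP.
exists ((lead_coef q)^-1 *: q); split.
- by rewrite monicE lead_coefZ mulVf ?lead_coef_eq0.
- by rewrite map_polyZ /root hornerZ (rootP qz) mulr0.
move=> r rz; rewrite dvdpZl ?invr_eq0 ?lead_coef_eq0 //.
apply: contraT => nqr.
have := ltn_modp r q; rewrite q0 sq ltnNge minn //.
apply/asboolP; exists (r %% q); split=> //.
have := rz; rewrite {1}(divp_eq r q) rmorphD rmorphM /= /root hornerD hornerM (rootP qz).
by rewrite mulr0 add0r.
Qed.

(** Conjugates have equal multiplicity: [z] is a simple root of [q], so dividing [p] by [q] uses up
    only one factor ['X - z%:P]. *)
Lemma minimal_poly_exp_dvd (L : numFieldType) (z : L) (q p : {poly rat}) g :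
  q \is monic -> root (map_poly ratr q) z ->
  (forall r, root (map_poly ratr r) z -> q %| r) ->
  ('X - z%:P) ^+ g %| map_poly ratr p -> q ^+ g %| p.
Proof.
move=> qm qz minq; elim: g p => [|g IHg] p; first by rewrite !expr0 !dvd1p.
move=> dvd_p.
have /dvdpP[p' pE] : q %| p.
  apply: minq; rewrite -dvdp_XsubCl; apply: dvdp_trans dvd_p.
  by rewrite exprS dvdp_mulIl.
rewrite pE exprSr dvdp_mul //; apply: IHg.
have /factor_theorem[q1 q1E] := qz.
(* [z] is a simple root of [q]: otherwise [q] would divide its derivative. *)
have q1z : ~~ root q1 z.
  apply/negP => q1z.
  have : root (map_poly ratr q^`()) z.
    rewrite -deriv_map q1E derivM derivXsubC mulr1 /root hornerD hornerM.
    by rewrite hornerXsubC subrr mulr0 add0r (rootP q1z).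
  have sq : (1 < size q)%N.
    rewrite -(size_map_poly (ratr : {rmorphism rat -> L})).
    by apply: root_size_gt1 qz; rewrite map_poly_eq0 monic_neq0.
  have q'0 : q^`() != 0.
    apply/eqP => /polyP/(_ (size q).-2)/eqP; rewrite coef_deriv coef0.
    have -> : (size q).-2.+1 = (size q).-1 by rewrite -subn2 -subn1; lia.
    by rewrite -lead_coefE (monicP qm) pnatr_eq0; lia.
  by move/minq/(dvdp_leq q'0); rewrite leqNgt lt_size_deriv ?monic_neq0.
move: dvd_p; rewrite pE rmorphM /= q1E mulrA exprSr dvdp_mul2r ?polyXsubC_eq0 //.
rewrite Gauss_dvdpl //.
by apply: coprimep_expl; rewrite coprimep_sym coprimep_XsubC.
Qed.

(** By Gauss's lemma an integer polynomial proportional to ['X - x%:P] divides [p] over the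
    integers, so its leading coefficient is a unit. *)
Lemma rat_root_monic_int (p : {poly int}) (x : rat) :
  p \is monic -> root (map_poly intr p) x -> x \is a Num.int.
Proof.
move=> pm px.
have [p1 [a a0 p1E] [r pE]] : {p1 : {poly int} & {a | a != 0 & 'X - x%:P = a *: map_poly intr p1 :> {poly rat}} & {r | p = p1 * r}}.
  by apply: dvdpP_rat_int; rewrite dvdp_XsubCl.
have lp1 : lead_coef p1 \is a GRing.unit.
  apply/unitrP; exists (lead_coef r); rewrite mulrC -lead_coefM -pE.
  by split; apply/monicP.
have sp1 : size p1 = 2.
  by rewrite -size_rat_int_poly -(size_scale _ a0) -p1E size_XsubC.
have lE : lead_coef p1 = p1`_1 by rewrite /lead_coef sp1.
have /polyP/(_ 1%N) := p1E; rewrite coefB coefX coefC subr0 coefZ coef_map /= => e1.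
have /polyP/(_ 0%N) := p1E; rewrite coefB coefX coefC /= sub0r coefZ coef_map /= => e0.
have [u1|u1] : p1`_1 = 1 \/ p1`_1 = -1.
- by move: lp1; rewrite lE => /orP[]/eqP; [left|right].
- move: e1 e0; rewrite u1 mulr1 => <-; rewrite mul1r => /eqP; rewrite eqr_oppLR => /eqP ->.
  by rewrite rpredN intr_int.
move: e1 e0; rewrite u1 => /eqP; rewrite mulrN1 eq_sym eqr_oppLR => /eqP ->.
by rewrite mulN1r => /oppr_inj ->; exact: intr_int.
Qed.

Lemma adjacency_quadratic_root n (A : 'M[rat]_n.+1) (q : {poly rat}) :
  A^T = A -> (forall i j, A i j = 0 \/ A i j = 1) -> (forall i, A i i = 0) ->
  size q = 3 -> q \is monic -> horner_mx A q = 0 -> exists m, root q m.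
Proof.
move=> symA A01 A0 sq qm qA0.
have q2 : q`_2 = 1 by move/monicP: qm; rewrite /lead_coef sq.
have qE : horner_mx A q = A ^+ 2 + q`_1 *: A + (q`_0)%:M.
  have -> : q = 'X^2 + q`_1 *: 'X + (q`_0)%:P.
    apply/polyP => i; rewrite !coefE.
    by case: i => [|[|[|i]]]; rewrite ?q2 /= ?mulr0 ?mulr1 ?addr0 ?add0r // nth_default ?sq.
  rewrite !coefE /= !mulr0 !mulr1 !addr0 !add0r.
  by rewrite !rmorphD rmorphXn /= horner_mxZ horner_mx_X horner_mx_C.
move: qA0; rewrite qE => qA0; exists (- q`_0).
have sqA i j : A i j ^+ 2 = A i j by case: (A01 i j) => ->; rewrite expr2 ?mulr0 ?mulr1.
have deg i : \sum_j A i j = - q`_0.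
  have /matrixP/(_ i i) := qA0.
  rewrite expr2 !mxE A0 mulr0 addr0 eqxx mulr1n => /eqP.
  rewrite addr_eq0 => /eqP <-; apply: eq_bigr => j _.
  have -> : A j i = A i j by rewrite -[in RHS]symA mxE.
  by rewrite -expr2 sqA.
(* The graph is regular of degree [- q`_0], so the all-one vector is an eigenvector. *)
pose u : 'cV[rat]_n.+1 := const_mx 1.
have Au : A *m u = (- q`_0) *: u.
  apply/colP => i; rewrite !mxE mulr1 -(deg i); apply: eq_bigr => j _.
  by rewrite mxE mulr1.
have : (A ^+ 2 + q`_1 *: A + (q`_0)%:M) *m u = 0 by rewrite qA0 mul0mx.
rewrite !mulmxDl expr2 -[A * A]/(A *m A) -mulmxA Au -scalemxAr Au -scalemxAl Au mul_scalar_mx.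
move/colP/(_ 0); rewrite !mxE !mulr1 => e.
rewrite /root (horner_coef_wide _ (n := 3)) ?sq // !big_ord_recl big_ord0 /= q2.
by apply/eqP; rewrite -[RHS]e /bump /=; ring.
Qed.

Lemma eigenvalue_int (R : realType) n (A : 'M[int]_n.+1) (z : R) (r : nat) :
  A^T = A -> (forall i j, A i j = 0 \/ A i j = 1) -> (forall i, A i i = 0) ->
  (\rank (map_mx intr A - z%:M : 'M[R]_n.+1)%R <= r)%N -> (2 * r <= n.+1)%N -> z \is a Num.int.
Proof.
move=> symA A01 A0 rk r2.
pose AQ : 'M[rat]_n.+1 := map_mx intr A.
have AR : map_mx intr A = map_mx ratr AQ :> 'M[R]_n.+1.
  by apply/matrixP => i j; rewrite !mxE ratr_int.
have charQ : char_poly AQ = map_poly intr (char_poly A) by rewrite map_char_poly.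
have charm := char_poly_monic AQ.
have [g g2 dvd_g] : exists2 g, (n.+1 <= 2 * g)%N & ('X - z%:P) ^+ g %| map_poly ratr (char_poly AQ).
  rewrite map_char_poly -AR.
  exists (n.+1 - \rank (map_mx intr A - z%:M : 'M[R]_n.+1)%R)%N; last exact: dvdp_char_poly_rank.
  by move: rk; set k := \rank _; lia.
have rootz : root (map_poly ratr (char_poly AQ)) z.
  rewrite -dvdp_XsubCl; apply: dvdp_trans dvd_g.
  by case: g g2 => // g _; rewrite exprS dvdp_mulIl.
have [q [qm qz minq]] := minimal_poly_exists (monic_neq0 charm) rootz.
have qg : q ^+ g %| char_poly AQ by exact: minimal_poly_exp_dvd dvd_g.
suff [x zE] : exists x : rat, z = ratr x.
  have : x \is a Num.int.
    apply: (rat_root_monic_int (char_poly_monic A)).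
    by rewrite -charQ; move: rootz; rewrite zE fmorph_root.
  by case/intrP => m xE; rewrite zE xE ratr_int intr_int.
have sg := dvdp_leq (monic_neq0 charm) qg.
have szqg : size (q ^+ g) = ((size q).-1 * g).+1.
  by rewrite -size_exp prednK // size_poly_gt0 monic_neq0 ?monic_exp.
rewrite size_char_poly szqg in sg.
have sq1 : (1 < size q)%N.
  rewrite -(size_map_poly (ratr : {rmorphism rat -> R})).
  by apply: root_size_gt1 qz; rewrite map_poly_eq0 monic_neq0.
(* Degree 3 or more would force [3 g <= n.+1 <= 2 g], while [g > 0]. *)
have sq3 : (size q <= 3)%N.
  rewrite leqNgt; apply/negP => sq; suff : (3 * g <= n.+1)%N by lia.
  rewrite -ltnS; apply: leq_trans sg; rewrite ltnS leq_mul2r; apply/orP; right; lia.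
have eval : z ^+ 2 *+ (size q == 3) + z * ratr q`_1 + ratr q`_0 = 0.
  rewrite -(rootP qz) (horner_coef_wide _ (n := 3)) ?size_map_poly //.
  rewrite !big_ord_recl big_ord0 /= !coef_map /= /bump /=.
  have [s3|s3] := eqVneq (size q) 3.
    have -> : q`_2 = 1 by move/monicP: qm; rewrite /lead_coef s3.
    by rewrite rmorph1 /=; ring.
  rewrite [q`_2]nth_default; last by rewrite -ltnS ltn_neqAle s3.
  by rewrite rmorph0 /=; ring.
have [s3|s3] := eqVneq (size q) 3; last first.
  have s2 : size q = 2 by lia.
  have q1 : q`_1 = 1 by move/monicP: qm; rewrite /lead_coef s2.
  exists (- q`_0); move: eval; rewrite s2 /= q1 rmorph1 rmorphN /=; lra.
(* Now [2 g <= n.+1 <= 2 g], so the two monic sides have equal size. *)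
have charE : char_poly AQ = q ^+ g.
  apply/eqP; rewrite -eqp_monic ?monic_exp // eqp_sym -dvdp_size_eqp //.
  rewrite size_char_poly szqg s3 /=.
  by apply/eqP; move: sg; rewrite s3 /=; lia.
have symAQ : AQ^T = AQ by rewrite /AQ map_trmx symA.
have symq : (horner_mx AQ q)^T = horner_mx AQ q.
  elim/poly_ind: (q) => [|p c IH]; first by rewrite rmorph0 trmx0.
  rewrite rmorphD rmorphM /= horner_mx_X horner_mx_C linearD /= tr_scalar_mx.
  rewrite trmx_mul IH symAQ; congr (_ + _).
  by have := congr1 (horner_mx AQ) (mulrC 'X p); rewrite !rmorphM /= horner_mx_X.
have qA0 : horner_mx AQ q = 0.
  apply: (sym_nilpotent_eq0 (m := g) symq).
  by rewrite -rmorphXn /= -charE Cayley_Hamilton.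
have [||m mq] := adjacency_quadratic_root symAQ _ _ s3 qm qA0.
- by move=> i j; rewrite mxE; case: (A01 i j) => ->; [left|right].
- by move=> i; rewrite mxE A0.
have := eval; rewrite s3 eqxx mulr1n => ez.
have em : m ^+ 2 + m * q`_1 + q`_0 = 0.
  rewrite -[RHS](rootP mq) (horner_coef_wide _ (n := 3)) ?s3 //.
  rewrite !big_ord_recl big_ord0 /= /bump /=.
  have -> : q`_2 = 1 by move/monicP: qm; rewrite /lead_coef s3.
  by ring.
(* By Vieta the other root of [q] is [- m - q_1], so [z] is rational whichever root it is. *)
have /eqP : (z - ratr m) * (z - ratr (- m - q`_1)) = 0.
  have := congr1 (ratr : rat -> R) em; rewrite !rmorphD rmorphXn rmorphM rmorph0 /= => em'.
  rewrite !rmorphN /=; apply: etrans (etrans (congr2 (fun a b => a - b) ez em') (subrr 0)).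
  ring.
by rewrite mulf_eq0 !subr_eq0 => /orP[]/eqP ->; eexists.
Qed.

(** * The bound by [Ufun] and the trace-rank inequality *)

(** The hypothesis gives [(k - 1/2)^2 <= N (n - 1) / (4 (n - N))], which does not increase with [n]
    and equals [(2 N - 1) / 4] at [n = 2 N]. This is at most the radicand in [Ufun], and integrality
    of [k] carries the bound through the floor. *)
Lemma int_abs_le_Ufun (R : realType) (k : R) (N n : nat) :
  k \is a Num.int -> (0 < N)%N -> (2 * N <= n)%N ->
  (n%:R * (k - 2^-1)) ^+ 2 <= N%:R * (n%:R * (k - 2^-1) ^+ 2 + n%:R * (n%:R - 1) / 4) ->
  `|k| <= (Ufun R N)%:~R.
Proof.
move=> /intrP[m ->] N0 Nn le_c.
rewrite /Ufun -intr_norm ler_int floor_ge_int.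
set c : R := m%:~R - 2^-1 in le_c.
set S := N%:R ^+ 2 / _ + _.
have n1 : 1 <= N%:R :> R by rewrite ler1n.
have nN : 2 * N%:R <= n%:R :> R by rewrite -natrM ler_nat.
have le1 : (n%:R - N%:R) * c ^+ 2 <= N%:R * (n%:R - 1) / 4.
  rewrite -(ler_pM2l (_ : 0 < n%:R)); last lra.
  by move: le_c; rewrite exprMn; lra.
have le2 : c ^+ 2 <= (2 * N%:R - 1) / 4.
  rewrite -(ler_pM2l (_ : 0 < n%:R - N%:R)); last lra.
  apply: le_trans le1 _; nra.
have le3 : (2 * N%:R - 1) / 4 <= S.
  (* For [N = 1] the quotient in [Ufun] is [1 / 0 = 0]. *)
  rewrite /S; case: (ltnP 1 N) => N1; last first.
    have -> : N = 1%N by lia.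
    by rewrite mulr1 subrr invr0 mulr0; lra.
  have N2 : 2 <= N%:R :> R by rewrite ler_nat.
  suff : (N%:R - 1) / 2 <= N%:R ^+ 2 / (2 * N%:R - 2) :> R by lra.
  by rewrite ler_pdivlMr; [nra|lra].
have le4 : `|c| <= Num.sqrt S by rewrite -sqrtr_sqr ler_wsqrtr // (le_trans le2).
rewrite intr_norm; move: le4; rewrite /c !ler_norml => /andP[]; set s := Num.sqrt _ => *.
by apply/andP; split; lra.
Qed.

(** Cauchy-Schwarz for the trace form on [M] and a projection [P]: [M P = M] makes the inner product
    [tr M], and the squared norm of [P] is its trace, the rank. *)
Lemma trace_sqr_le_rank (F : realFieldType) n (M : 'M[F]_n) :
  (\tr M) ^+ 2 <= (\rank M)%:R * \sum_i \sum_j M i j ^+ 2.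
Proof.
have := row_base_free M; have := mulmx_base M.
move: (col_base M) (row_base M) => C D MCD freeD.
set r := \rank M; pose E := D *m D^T.
have trsq p q (A : 'M[F]_(p, q)) : \tr (A *m A^T) = \sum_i \sum_j A i j ^+ 2.
  by apply: eq_bigr => i _; rewrite mxE; apply: eq_bigr => j _; rewrite mxE.
(* [E] is the Gram matrix of independent rows: [v E = 0] makes the squared norm of [v D] vanish. *)
have unitE : E \in unitmx.
  rewrite -row_free_unit -kermx_eq0; apply/rowV0P => v /sub_kermxP vE.
  have vD : v *m D = 0.
    have /eqP : \tr ((v *m D) *m (v *m D)^T) = 0.
      by rewrite trmx_mul mulmxA -(mulmxA v) vE mul0mx mxtrace0.
    rewrite trsq big_ord1 psumr_eq0 => [/allP v0|j _]; last exact: sqr_ge0.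
    apply/rowP => j; rewrite [RHS]mxE; apply/eqP.
    by have := v0 j (mem_index_enum _); rewrite sqrf_eq0.
  by apply/eqP; rewrite -(mulmx_free_eq0 _ freeD) vD.
(* [P] is the orthogonal projection onto the row space of [M]; minimizing
   [||M - t P||^2 >= 0] over [t] gives the inequality. *)
pose P := D^T *m invmx E *m D.
have DP : D *m P = D by rewrite /P !mulmxA -/E mulmxV // mul1mx.
have MP : M *m P = M by rewrite -[in LHS]MCD -mulmxA DP.
have symE : (invmx E)^T = invmx E by rewrite trmx_inv /E trmx_mul trmxK.
have symP : P^T = P by rewrite /P !trmx_mul trmxK symE mulmxA.
have PP : P *m P = P by rewrite {1}/P -mulmxA DP.
have PMT : P *m M^T = M^T by rewrite -[in LHS]symP -trmx_mul MP.
have trP : \tr P = r%:R.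
  by rewrite /P mxtrace_mulC mulmxA -/E mulmxV // mxtrace1.
have key t : 0 <= \sum_i \sum_j M i j ^+ 2 - t * \tr M *+ 2 + t ^+ 2 * r%:R.
  have <- : \tr ((M - t *: P) *m (M - t *: P)^T) =
      \sum_i \sum_j M i j ^+ 2 - t * \tr M *+ 2 + t ^+ 2 * r%:R.
    have -> : (M - t *: P)^T = M^T - t *: P by rewrite raddfB /= linearZ /= symP.
    rewrite mulmxBl !mulmxBr -!scalemxAl -!scalemxAr MP PP PMT.
    rewrite !raddfB /= !linearZ /= mxtrace_tr trsq trP.
    by rewrite mulr2n expr2 /GRing.scale /=; ring.
  by rewrite trsq; do 2!(apply: sumr_ge0 => ? _); exact: sqr_ge0.
have [r0|r0] := posnP r.
  have /eqP -> : M == 0 by rewrite -mxrank_eq0 -/r r0.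
  by rewrite mxtrace0 expr0n r0 mul0r.
have rp : 0 < r%:R :> F by rewrite ltr0n.
(* The minimizing [t] is [\tr M / r]. *)
have := key (\tr M / r%:R); set S := \sum_i _; set T := \tr M.
rewrite -(pmulr_rge0 _ rp).
have -> : r%:R * (S - T / r%:R * T *+ 2 + (T / r%:R) ^+ 2 * r%:R) = r%:R * S - T ^+ 2.
  by rewrite mulr2n; field; rewrite gt_eqF.
by rewrite subr_ge0.
Qed.

(** * Homogeneous polynomials on the sphere and ranks of polynomials in the Gram matrix *)

(* Degree-[m] monomials in [d] variables are sorted [m]-tuples over ['I_d], evaluated
   along the family [x]. *)
Definition mono_row (R : comNzRingType) d n (x : 'I_n -> 'rV[R]_d) (t : seq 'I_d) : 'rV[R]_n :=
  \row_j \prod_(i <- t) x j 0 i.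

(** The row space consists of the value vectors, at the points [x j], of forms of degree [m]; sorted
    tuples list each monomial once. *)
Definition mono_span (R : fieldType) d n (x : 'I_n -> 'rV[R]_d) m : 'M[R]_n :=
  (\sum_(t : m.-tuple 'I_d | sorted leq (map val t)) <<mono_row x t>>)%MS.

Lemma rank_mono_span (R : fieldType) d n (x : 'I_n -> 'rV[R]_d.+1) m :
  (\rank (mono_span x m) <= 'C(m + d, m))%N.
Proof.
rewrite -card_sorted_tuples -sum1dep_card /mono_span.
apply: leq_trans (_ : (\sum_(t : m.-tuple 'I_d.+1 | sorted leq (map val t)) \rank <<mono_row x t>> <= _)%N).
  exact: (mxrank_sum_leqif _).1.
by apply: leq_sum => t _; rewrite mxrank_gen rank_leq_row.
Qed.

Lemma mono_row_span (R : fieldType) d n (x : 'I_n -> 'rV[R]_d) m (t : m.-tuple 'I_d) :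
  (mono_row x t <= mono_span x m)%MS.
Proof.
pose le (i j : 'I_d) := (i <= j)%N.
have szt : size (sort le t) == m by rewrite size_sort size_tuple.
have -> : mono_row x t = mono_row x (Tuple szt).
  apply/rowP => j; rewrite !mxE; apply: perm_big.
  by rewrite perm_sym /= perm_sort.
apply: (submx_trans (B := <<mono_row x (Tuple szt)>>%MS)); first by rewrite genmxE.
apply: (sumsmx_sup (Tuple szt)) => //=.
by rewrite sorted_map; apply: sort_sorted => i j; exact: leq_total.
Qed.

(** The diagonal matrix multiplies value vectors pointwise by coordinate [i], which prepends [i] to
    the tuple of a monomial. *)
Lemma mono_span_mul_coord (R : fieldType) d n (x : 'I_n -> 'rV[R]_d) m i :
  (mono_span x m *m diag_mx (\row_j x j 0 i) <= mono_span x m.+1)%MS.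
Proof.
rewrite /mono_span sumsmxMr; apply/sumsmx_subP => t _.
rewrite (eqmxMr _ (genmxE _)).
have -> : mono_row x t *m diag_mx (\row_j x j 0 i) = mono_row x [tuple of i :: t].
  by apply/rowP => j; rewrite mul_mx_diag !mxE big_cons mulrC.
exact: mono_row_span.
Qed.

Lemma mono_span_mul_dotv (R : realType) d n (x : 'I_n -> 'rV[R]_d) m y :
  (mono_span x m *m diag_mx (\row_j dotv (x j) y) <= mono_span x m.+1)%MS.
Proof.
have -> : diag_mx (\row_j dotv (x j) y) = \sum_i y 0 i *: diag_mx (\row_j x j 0 i).
  apply/matrixP => a b; rewrite summxE !mxE /dotv -sumrMnl; apply: eq_bigr => i _.
  by rewrite !mxE mulrC mulrnAr.
rewrite mulmx_sumr; apply: summx_sub => i _.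
by rewrite -scalemxAr scalemx_sub // mono_span_mul_coord.
Qed.

(* Multiplying by [|x|^2 = 1] raises the degree by two. *)
Lemma mono_span_add2 (R : realType) d n (x : 'I_n -> 'rV[R]_d) m :
  (forall j, dotv (x j) (x j) = 1) -> (mono_span x m <= mono_span x m.+2)%MS.
Proof.
move=> x1.
have idE : 1%:M = \sum_i diag_mx (\row_j x j 0 i) *m diag_mx (\row_j x j 0 i) :> 'M[R]_n.
  apply/matrixP => a b; rewrite summxE mxE -(x1 a) -sumrMnl; apply: eq_bigr => i _.
  by rewrite mul_mx_diag !mxE; case: eqP => [->|]; rewrite ?mul0r.
rewrite -[X in (X <= _)%MS]mulmx1 idE mulmx_sumr; apply: summx_sub => i _.
rewrite mulmxA; apply: submx_trans (mono_span_mul_coord x m.+1 i).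
exact/submxMr/mono_span_mul_coord.
Qed.

Lemma dotv_exp_span (R : realType) d n (x : 'I_n -> 'rV[R]_d) y m :
  (\row_j dotv (x j) y ^+ m <= mono_span x m)%MS.
Proof.
elim: m => [|m IHm].
  have -> : \row_j dotv (x j) y ^+ 0 = mono_row x [tuple].
    by apply/rowP => j; rewrite !mxE big_nil.
  exact: mono_row_span.
have -> : \row_j dotv (x j) y ^+ m.+1 =
    (\row_j dotv (x j) y ^+ m) *m diag_mx (\row_j dotv (x j) y).
  by apply/rowP => j; rewrite mul_mx_diag !mxE exprSr.
by apply: submx_trans (mono_span_mul_dotv x m y); exact: submxMr.
Qed.

(** As a function of [x j], each row is a combination of powers up to [e.+1] of a linear form.
    Raising degrees by two on the sphere brings them all to [e.+1] or [e]. *)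
Lemma rank_poly_gram (R : realType) d n (x : 'I_n -> 'rV[R]_d.+1) (p : {poly R}) e :
  (forall j, dotv (x j) (x j) = 1) -> (size p <= e.+2)%N ->
  (\rank (\matrix_(i, j) p.[dotv (x j) (x i)] : 'M[R]_n)
    <= 'C(e.+1 + d, e.+1) + 'C(e + d, e))%N.
Proof.
move=> x1 sp; set M := \matrix_(i, j) _.
have spanS k l : (mono_span x k <= mono_span x (k + l.*2))%MS.
  elim: l => [|l IHl]; first by rewrite addn0.
  by rewrite doubleS !addnS; apply: submx_trans IHl (mono_span_add2 _ x1).
have spanE m : (m <= e.+1)%N -> (mono_span x m <= mono_span x e.+1 + mono_span x e)%MS.
  (* The parity of [e.+1 - m] decides which span receives degree [m]. *)
  move=> me; have := odd_double_half (e.+1 - m); case: odd => /= h.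
    apply: submx_trans (addsmxSr _ _).
    by have -> : e = (m + ((e.+1 - m)./2).*2)%N by lia.
  apply: submx_trans (addsmxSl _ _).
  by have -> : e.+1 = (m + ((e.+1 - m)./2).*2)%N by lia.
have sub : (M <= mono_span x e.+1 + mono_span x e)%MS.
  apply/row_subP => i.
  have -> : row i M = \sum_(k < e.+2) p`_k *: \row_j dotv (x j) (x i) ^+ k.
    apply/rowP => j; rewrite !mxE (horner_coef_wide _ sp) summxE.
    by apply: eq_bigr => k _; rewrite !mxE.
  apply: summx_sub => k _; apply: scalemx_sub.
  by apply: submx_trans (dotv_exp_span _ _ _) _; apply: spanE; rewrite -ltnS.
apply: leq_trans (mxrankS sub) _.
apply: leq_trans (mxrank_adds_leqif _ _).1 _.
by rewrite leq_add // rank_mono_span.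
Qed.

(** * Lagrange polynomials evaluated on the Gram matrix *)

Definition lagrange (F : fieldType) s (beta : 'I_s -> F) i : {poly F} :=
  \prod_(j < s | j != i) ((beta i - beta j)^-1 *: ('X - (beta j)%:P)).

Lemma size_lagrange (F : fieldType) s (beta : 'I_s -> F) i :
  (size (lagrange beta i) <= s)%N.
Proof.
rewrite /lagrange scaler_prod; apply: leq_trans (size_scale_leq _ _) _.
rewrite -big_filter size_prod_XsubC.
have -> : size [seq j <- index_enum 'I_s | j != i] = #|predC1 i|.
  by rewrite size_filter -sum1_count sum1_card; apply: eq_card => j; rewrite !inE.
by rewrite cardC1 card_ord; case: s i {beta} => [[]|].
Qed.

Lemma horner_lagrange (F : fieldType) s (beta : 'I_s -> F) i t :
  (lagrange beta i).[t] = \prod_(j < s | j != i) ((t - beta j) / (beta i - beta j)).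
Proof.
rewrite horner_prod; apply: eq_bigr => j _.
by rewrite hornerZ hornerXsubC mulrC.
Qed.

Lemma lagrange_node (F : fieldType) s (beta : 'I_s -> F) i j :
  injective beta -> (lagrange beta i).[beta j] = (i == j)%:R.
Proof.
move=> binj; rewrite horner_lagrange; case: eqVneq => [<-|ij].
  by apply: big1 => l li; rewrite divff // subr_eq0 (inj_eq binj) eq_sym.
by rewrite (bigD1 j) 1?eq_sym //= subrr !mul0r.
Qed.

Theorem theorem5p1 (R : realType) (d s : nat) (X : seq 'rV[R]_d)
    (beta : 'I_s -> R) :
  (2 <= s)%N ->
  uniq X ->
  (forall x, x \in X -> dotv x x = 1) ->
  injective beta ->
  (forall x y, x \in X -> y \in X -> x != y -> exists i, dotv x y = beta i) ->
  (forall i, exists x y, [/\ x \in X, y \in X, x != y & dotv x y = beta i]) ->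
  let N := ('C(d + s - 2, s - 1) + 'C(d + s - 3, s - 2))%N in
  (2 * N <= size X)%N ->
  forall i : 'I_s,
    let k := \prod_(j < s | j != i) ((1 - beta j) / (beta i - beta j)) in
    k \is a Num.int /\ `|k| <= (Ufun R N)%:~R.
Proof.
move=> s2 Xuniq X1 binj Xbeta betaX N nN i k.
have [x0 [_ [Xx0 _ _ _]]] := betaX i.
(* Dimension 0 holds no unit vector; afterwards the [d.+1] coordinates fit the monomial count. *)
case: d X Xuniq X1 Xbeta betaX @N nN x0 Xx0 => [|d] X Xuniq X1 Xbeta betaX N nN x0 Xx0.
  by have := X1 _ Xx0; rewrite /dotv big_ord0 => /esym/eqP; rewrite oner_eq0.
have [n szX] : exists n, size X = n.+1 by case: (X) Xx0 => // a l _; exists (size l).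
pose x (j : 'I_n.+1) := nth 0 X j.
have xX j : x j \in X by rewrite mem_nth // szX.
have x_inj : injective x.
  by move=> a b /eqP; rewrite nth_uniq ?szX // => /eqP/val_inj.
have x1 j : dotv (x j) (x j) = 1 by exact: X1.
pose e := (s - 2)%N.
have NE : N = ('C(e.+1 + d, e.+1) + 'C(e + d, e))%N.
  by rewrite /N /e; congr ('C(_, _) + 'C(_, _))%N; lia.
have rankN (p : {poly R}) : (size p <= s)%N ->
    (\rank (\matrix_(a, b) p.[dotv (x b) (x a)]) <= N)%N.
  by move=> sp; rewrite NE; apply: rank_poly_gram => //; rewrite /e; lia.
pose L := lagrange beta i.
have L1 : L.[1] = k by rewrite horner_lagrange.
have sL : (size L <= s)%N by exact: size_lagrange.
have dotC (u v : 'rV[R]_d.+1) : dotv u v = dotv v u.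
  by apply: eq_bigr => l _; rewrite mulrC.
have L01 a b : a != b -> L.[dotv (x b) (x a)] = (dotv (x a) (x b) == beta i)%:R.
  move=> ab; have [|l bl] := Xbeta _ _ (xX a) (xX b); first by rewrite (inj_eq x_inj).
  by rewrite dotC bl lagrange_node // (inj_eq binj) eq_sym.
have kint : k \is a Num.int.
  pose A : 'M[int]_n.+1 := \matrix_(a, b) ((a != b) && (dotv (x a) (x b) == beta i))%:R.
  (* The eigenvalue is [- k]: [A + k] is [L] evaluated on the Gram matrix, with diagonal [L.[1] =
     k]. *)
  rewrite -[k]opprK rpredN.
  apply: (@eigenvalue_int _ _ A _ N).
  - by apply/matrixP => a b; rewrite !mxE eq_sym dotC.
  - by move=> a b; rewrite mxE; case: (_ && _); [right|left].
  - by move=> a; rewrite mxE eqxx.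
  - suff -> : map_mx intr A - (- k)%:M = \matrix_(a, b) L.[dotv (x b) (x a)] by exact: rankN.
    apply/matrixP => a b; rewrite !mxE mulNrn opprK; case: eqVneq => [<-|ab] /=.
      by rewrite x1 L1 add0r mulr1n.
    by rewrite L01 // mulr0n addr0; case: (_ == _).
  - by rewrite -szX.
split=> //; apply: (@int_abs_le_Ufun _ _ N n.+1) => //.
- by rewrite NE addn_gt0 !bin_gt0 leq_addr.
- by rewrite -szX.
(* After the shift by 1/2 every off-diagonal square is 1/4, so the sum of squares does not depend on
   the graph. *)
pose M : 'M[R]_n.+1 := \matrix_(a, b) (L - (2^-1)%:P).[dotv (x b) (x a)].
have Mdiag a : M a a = k - 2^-1 by rewrite mxE hornerD hornerN hornerC x1 L1.
have Moff a b : a != b -> M a b ^+ 2 = 4^-1.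
  by move=> ab; rewrite mxE hornerD hornerN hornerC L01 //; case: (_ == _) => /=; field.
have trM : \tr M = n.+1%:R * (k - 2^-1).
  by rewrite /mxtrace (eq_bigr _ (fun a _ => Mdiag a)) sumr_const card_ord mulr_natl.
have sqM : \sum_a \sum_b M a b ^+ 2 = n.+1%:R * (k - 2^-1) ^+ 2 + n.+1%:R * (n.+1%:R - 1) / 4.
  rewrite (eq_bigr (fun=> (k - 2^-1) ^+ 2 + n%:R / 4)) => [|a _].
    by rewrite sumr_const card_ord -mulr_natl -natr1; field.
  rewrite (bigD1 a) //= Mdiag (eq_bigr (fun=> 4^-1)) => [|b ba]; last by rewrite Moff // eq_sym.
  by rewrite sumr_const cardC1 card_ord mulr_natl.
rewrite -trM -sqM; apply: le_trans (trace_sqr_le_rank M) _.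
apply: ler_wpM2r; first by do 2!(apply: sumr_ge0 => ? _); exact: sqr_ge0.
rewrite ler_nat; apply: rankN.
apply: leq_trans (size_polyD _ _) _; rewrite geq_max sL size_polyN.
by apply: leq_trans (size_polyC_leq1 _) _; lia.
Qed.
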